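(* There are no regular intersecting families in $\mathcal V_n^k$ for $n\ge 2k$.
   Context: $V(n,q)$ is the $n$-dimensional vector space over the field with $q$ elements and $\mathcal V_n^k$ is the family of all its $k$-dimensional subspaces. A family of subspaces is intersecting if any two of its members intersect in a subspace of dimension at least $1$. A regular intersecting family is an intersecting family $\mathcal F$ in which all $1$-subspaces have the same popularity, i.e. the number of members of $\mathcal F$ containing a given $1$-dimensional subspace of $V(n,q)$ is the same for all $1$-dimensional subspaces. *)

(* Defs.v *)
From HB Require Import structures.
From mathcomp Require Import all_boot all_algebra.

Set Implicit Arguments.
Unset Strict Implicit.
Unset Printing Implicit Defensive.

(* [VectorInternalTheory] exposes the encoding of a subspace as a reduced matrix;
   over a finite field it makes [{vspace V}] a finType, so that families of
   subspaces are [{set {vspace V}}]. *)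
Section VspaceFinite.
Import VectorInternalTheory.
Variables (K : finFieldType) (V : vectType K).
HB.instance Definition _ := [Countable of {vspace V} by <:].
HB.instance Definition _ := [Finite of {vspace V} by <:].
End VspaceFinite.

Section Families.
Variables (K : finFieldType) (V : vectType K).
Implicit Types (k : nat) (U W L : {vspace V}) (F : {set {vspace V}}).

Definition subspaces k : {set {vspace V}} := [set U : {vspace V} | \dim U == k].

(* The two members may coincide; this matters only for the zero subspace, which
   does not meet itself in positive dimension. *)
Definition intersecting F : Prop :=
  forall U W, U \in F -> W \in F -> 1 <= \dim (U :&: W)%VS.

Definition popularity F L : nat := #|[set U in F | (L <= U)%VS]|.

Definition equipopular F : Prop :=
  forall L L', \dim L = 1 -> \dim L' = 1 -> popularity F L = popularity F L'.

(* The empty family, for which all conditions hold vacuously, is excluded. *)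
Definition regular_intersecting F : Prop :=
  [/\ F != set0, intersecting F & equipopular F].

End Families.

(* Main.v *)
Require Import Defs.
From mathcomp Require Import all_boot all_algebra.
From mathcomp Require Import zify.
Import GRing.Theory VectorInternalTheory.

(** The proof compares two double counts of incidences between nonzero vectors
    and members of the family F.  If every 1-subspace has popularity d, then
    every nonzero vector lies in exactly d members, so for any subspace U the
    incidences with vectors of U number (q^(dim U) - 1) d; this is
    [sum_popularity].

    Taking U to be the whole space gives |F| (q^k - 1) = (q^n - 1) d.  Taking U
    to be a member of F, every member shares a nonzero vector with U, whence
    |F| <= (q^k - 1) d.  Eliminating d and cancelling |F| > 0 leaves
    q^n - 1 <= (q^k - 1)^2.  Since n >= 2k, the left side is at least
    (q^k)^2 - 1, while q^k > 1 makes the right side strictly smaller.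

    That k is positive, hence q^k > 1, comes from intersecting a member of F
    with itself. *)

Section Counting.
Variables (K : finFieldType) (V : vectType K).
Implicit Types (U W : {vspace V}) (F : {set {vspace V}}).

(** An abstract finite-dimensional space is not a finite type, so vectors are
    counted through their coordinate rows, which are. *)
Definition nonzero_coords U : {set 'rV[K]_(dim V)} :=
  [set x | (r2v x != 0%R :> V) && (r2v x \in U)].

(** Coordinates with respect to [vbasis U] match these rows with those of length
    [\dim U]. *)
Lemma card_coords U :
  #|[set x : 'rV[K]_(dim V) | r2v x \in U]| = #|K| ^ \dim U.
Proof.
pose comb (c : 'rV[K]_(\dim U)) : V :=
  (\sum_i c ord0 i *: (vbasis U)`_i)%R.
have comb_inj : injective (v2r \o comb).
  move=> c c' /v2r_inj eq_cc'; apply/rowP=> i.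
  have freeU := basis_free (vbasisP U).
  by rewrite -(coord_sum_free (c ord0) i freeU) [X in coord _ _ X]eq_cc'
             coord_sum_free.
rewrite -[\dim U]mul1n -card_mx -(card_imset _ comb_inj).
apply: eq_card => x; rewrite inE; apply/idP/imsetP => [xU | [c _ ->]].
  exists (\row_i coord (vbasis U) i (r2v x))%R => //.
  rewrite /= /comb -[LHS]r2vK [in LHS](coord_vbasis xU).
  by congr v2r; apply: eq_bigr => i _; rewrite mxE.
by rewrite /= v2rK; apply: rpred_sum => i _; rewrite rpredZ ?vbasis_mem ?memt_nth.
Qed.

Lemma card_nonzero_coords U : #|nonzero_coords U| = (#|K| ^ \dim U).-1.
Proof.
rewrite -card_coords [in RHS](cardsD1 (v2r 0%R)) inE v2rK mem0v /=.
by apply: eq_card => x; rewrite !inE -(can_eq r2vK) v2rK.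
Qed.

(** Double counting: a nonzero v of U lying in a member W of F is on one side a
    vector of [U :&: W], on the other a line [<[v]>] below W. *)
Lemma sum_popularity F U d :
    (forall v : V, v != 0%R -> popularity F <[v]>%VS = d) ->
  \sum_(W in F) (#|K| ^ \dim (U :&: W)%VS).-1 = (#|K| ^ \dim U).-1 * d.
Proof.
move=> popF; rewrite -card_nonzero_coords -sum_nat_const.
transitivity
  (\sum_(W in F) \sum_(x in nonzero_coords U | r2v x \in W) 1).
  apply: eq_bigr => W _; rewrite -card_nonzero_coords sum1_card.
  by apply: eq_card => x; rewrite [RHS]unfold_in !inE memv_cap andbA.
rewrite (exchange_big_dep (mem (nonzero_coords U))) /=; last first.
  by move=> W x _ /andP[].
apply: eq_bigr => x xU; rewrite sum1_card.
have /andP[nz_x _] : (r2v x != 0%R) && (r2v x \in U) by rewrite inE in xU.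
rewrite -(popF _ nz_x).
by apply: eq_card => W; rewrite [LHS]unfold_in /= xU inE.
Qed.

Lemma equipopular_vector F : equipopular F ->
  exists d, forall v : V, v != 0%R -> popularity F <[v]>%VS = d.
Proof.
(* If V is zero, [vpick fullv] is the zero vector and the claim is vacuous. *)
move=> eqF; set v0 := vpick (fullv : {vspace V}).
exists (popularity F <[v0]>%VS) => v nz_v.
have nz_v0 : v0 != 0%R.
  rewrite vpick0 -subv0; apply: contra nz_v => /subvP/(_ v (memvf v)).
  by rewrite memv0.
by apply: eqF; rewrite dim_vline ?nz_v ?nz_v0.
Qed.

End Counting.

Theorem proposition4p3 (q n k : nat) (K : finFieldType) (V : vectType K) :
  #|K| = q -> \dim (fullv : {vspace V}) = n -> 2 * k <= n ->
  ~ exists F : {set {vspace V}},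
      F \subset subspaces V k /\ regular_intersecting F.
Proof.
move=> cardK dimV le_2k_n [F [/subsetP Fk [/set0Pn[U UF] intF eqF]]].
have dimF W : W \in F -> \dim W = k by move/Fk; rewrite inE => /eqP.
have q_gt1 : 1 < q by rewrite -cardK card_finNzRing_gt1.
have k_gt0 : 0 < k by rewrite -(dimF _ UF) -[U]capvv intF.
have [d popF] := equipopular_vector _ _ _ eqF.
have total : #|F| * (q ^ k).-1 = (q ^ n).-1 * d.
  rewrite -dimV -cardK -(sum_popularity _ _ _ _ _ popF) -sum_nat_const.
  by apply: eq_bigr => W WF; rewrite capfv dimF.
have local : #|F| <= (q ^ k).-1 * d.
  rewrite -{1}(dimF _ UF) -cardK -(sum_popularity _ _ _ _ _ popF) -sum1_card.
  apply: leq_sum => W WF; rewrite cardK -ltnS prednK ?expn_gt0 ?(ltnW q_gt1) //.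
  by rewrite -{1}(expn0 q) ltn_exp2l ?intF.
have F_gt0 : 0 < #|F| by apply/card_gt0P; exists U.
have qk_gt1 : 1 < q ^ k by rewrite -{1}(expn0 q) ltn_exp2l.
have le_qn : q ^ k * q ^ k <= q ^ n.
  by rewrite -expnD addnn -mul2n leq_exp2l.
have : #|F| * (q ^ n).-1 <= #|F| * ((q ^ k).-1 * (q ^ k).-1).
  rewrite [leqRHS]mulnA total -[leqRHS]mulnA mulnC leq_mul2l.
  by rewrite (mulnC d) local orbT.
rewrite leq_pmul2l //.
move: (q ^ k) (q ^ n) qk_gt1 le_qn => a b; nia.
Qed.
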